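(* Consider FedAvg with full device participation, with $E\ge 1$ local steps per round and run for $T\ge 1$ steps with $E\mid T$, applied to $F=\sum_{k=1}^N p_kF_k$. Assume: (1) each $F_k$ is $L$-smooth: $F_k(\mathbf v)\le F_k(\mathbf w)+(\mathbf v-\mathbf w)^\top\nabla F_k(\mathbf w)+\frac L2\|\mathbf v-\mathbf w\|_2^2$ for all $\mathbf v,\mathbf w$; (2) each $F_k$ is $\mu$-strongly convex, $\mu>0$: $F_k(\mathbf v)\ge F_k(\mathbf w)+(\mathbf v-\mathbf w)^\top\nabla F_k(\mathbf w)+\frac \mu2\|\mathbf v-\mathbf w\|_2^2$ for all $\mathbf v,\mathbf w$; (3) $\mathbb E\|\nabla F_k(\mathbf w_t^k,\xi_t^k)-\nabla F_k(\mathbf w_t^k)\|^2\le\sigma_k^2$ for all $k=1,\dots,N$ and $t=0,\dots,T-1$; (4) $\mathbb E\|\nabla F_k(\mathbf w_t^k,\xi_t^k)\|^2\le G^2$ for all $k=1,\dots,N$ and $t=0,\dots,T-1$. Let $\kappa=\frac L\mu$, $\gamma=\max\{8\kappa,E\}$ and let the learning rate be $\eta_t=\frac{2}{\mu(\gamma+t)}$. Then $$\mathbb E[F(\mathbf w_T)]-F^*\le\frac{\kappa}{\gamma+T-1}\left(\frac{2B}{\mu}+\frac{\mu\gamma}{2}\,\mathbb E\|\mathbf w_1-\mathbf w^*\|^2\right),\qquad B=\sum_{k=1}^N p_k^2\sigma_k^2+6L\Gamma+8(E-1)^2G^2 .$$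
   Context: Problem: $N$ devices with weights $p_k\ge0$, $\sum_{k=1}^Np_k=1$. Device $k$ holds data $x_{k,1},\dots,x_{k,n_k}$ and has the differentiable local objective $F_k(\mathbf w)=\frac1{n_k}\sum_{j=1}^{n_k}\ell(\mathbf w;x_{k,j})$ on $\mathbb R^d$, where $\ell$ is a loss function differentiable in $\mathbf w$. For a data point $\xi$ of device $k$, $\nabla F_k(\mathbf w,\xi)$ denotes the stochastic gradient $\nabla_{\mathbf w}\ell(\mathbf w;\xi)$. The global objective is $F=\sum_kp_kF_k$; $\mathbf w^*$ is its minimizer, $F^*=F(\mathbf w^* )$, $F_k^*=\min F_k$, and $\Gamma=F^*-\sum_{k=1}^Np_kF_k^*$. FedAvg with full participation: start from a fixed $\mathbf w_0$, $\mathbf w_0^k=\mathbf w_0$ for all $k$. Let $\mathcal I_E=\{nE: n=1,2,\dots\}$. For $t=0,1,\dots$ and every $k$, $$\mathbf v_{t+1}^k=\mathbf w_t^k-\eta_t\nabla F_k(\mathbf w_t^k,\xi_t^k),$$ where $\xi_t^k$ is drawn uniformly at random from device $k$'s data, independently across devices and steps; and $\mathbf w_{t+1}^k=\mathbf v_{t+1}^k$ if $t+1\notin\mathcal I_E$, while $\mathbf w_{t+1}^k=\sum_{j=1}^Np_j\mathbf v_{t+1}^j$ if $t+1\in\mathcal I_E$. For every $t$, $\mathbf w_t$ denotes the average $\sum_{k=1}^Np_k\mathbf w_t^k$ (which equals the common value of all $\mathbf w_t^k$ when $t\in\mathcal I_E$). $\|\cdot\|$ is the Euclidean norm. *)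

(* Defs.v *)
From HB Require Import structures.
From mathcomp Require Export all_boot all_order all_algebra.
From mathcomp Require Export all_classical all_reals all_analysis.
Export numFieldNormedType.Exports.

Set Implicit Arguments.
Unset Strict Implicit.
Unset Printing Implicit Defensive.

Import Order.TTheory GRing.Theory Num.Theory.

Local Open Scope classical_set_scope.
Local Open Scope ring_scope.

Section Euclidean.
Context {R : realType} {d : nat}.
Implicit Types (u v w : 'rV[R]_d) (f : 'rV[R]_d -> R).

Definition dotv u v : R := \sum_(i < d) u 0 i * v 0 i.

(* The library norm [`|v|] on matrices is the sup norm, so the Euclidean norm
   is defined here; both norms induce the same topology, hence the same notion
   of [differentiable]. *)
Definition enorm v : R := Num.sqrt (dotv v v).

(* The vector of partial derivatives; it is the gradient at the points where
   [f] is differentiable. *)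
Definition gradient f w : 'rV[R]_d := \row_(i < d) 'D_(delta_mx 0 i) f w.

Definition smooth (L : R) f :=
  forall v w, f v <= f w + dotv (v - w) (gradient f w)
                     + L / 2 * enorm (v - w) ^+ 2.

Definition strongly_convex (mu : R) f :=
  forall v w, f v >= f w + dotv (v - w) (gradient f w)
                     + mu / 2 * enorm (v - w) ^+ 2.

Definition is_minimizer f w := forall v, f w <= f v.

Definition is_minimum f (m : R) := exists2 w, is_minimizer f w & f w = m.

End Euclidean.

Section Sampling.
Context {d : measure_display} {Omega : measurableType d} {R : realType}.
Variable P : probability Omega R.

(* Finite ordinals carry no measurable structure in the library; they are
   equipped with the discrete one, so every subset is an event. *)
Definition discrete_rv (m : nat) (X : Omega -> 'I_m) :=
  forall A : set 'I_m, measurable (X @^-1` A).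

Definition uniform_rv (m : nat) (X : Omega -> 'I_m) :=
  forall j : 'I_m, P (X @^-1` [set j]) = (m%:R^-1)%:E.

Definition mutually_independent (J : eqType) (m : J -> nat)
    (X : forall j, Omega -> 'I_(m j)) :=
  forall s : seq J, uniq s -> forall A : (forall j, set 'I_(m j)),
    (P (\bigcap_(j in [set` s]) (X j @^-1` A j))
     = \prod_(j <- s) P (X j @^-1` A j))%E.

End Sampling.

Section FedAvg.
Context {R : realType} {d N : nat} {D : Type}.
Variable loss : 'rV[R]_d -> D -> R.

Definition local_objective (m : nat) (x : 'I_m -> D) (w : 'rV[R]_d) : R :=
  m%:R^-1 * \sum_(j < m) loss w (x j).

Definition stochastic_gradient (w : 'rV[R]_d) (z : D) : 'rV[R]_d :=
  gradient (fun u => loss u z) w.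

Definition global_objective (p : 'I_N -> R) (F : 'I_N -> 'rV[R]_d -> R)
    (w : 'rV[R]_d) : R :=
  \sum_(k < N) p k * F k w.

(* [z t k] is the data point used by device [k] at step [t]. Synchronization
   happens at the positive multiples of [E]; since [t.+1] is positive, this is
   the test [E %| t.+1]. *)
Fixpoint local_model (p : 'I_N -> R) (eta : nat -> R) (E : nat)
    (w0 : 'rV[R]_d) (z : nat -> 'I_N -> D) (t : nat) : 'I_N -> 'rV[R]_d :=
  if t is t'.+1 then
    let w := local_model p eta E w0 z t' in
    let v k := w k - eta t' *: stochastic_gradient (w k) (z t' k) in
    if (E %| t'.+1)%N then fun=> \sum_(j < N) p j *: v j else v
  else fun=> w0.

Definition average_model p eta E w0 z t : 'rV[R]_d :=
  \sum_(k < N) p k *: local_model p eta E w0 z t k.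

End FedAvg.

(* Main.v *)
Require Import Defs.
From mathcomp Require Import ring lra.
Import Order.TTheory GRing.Theory Num.Theory.
Local Open Scope classical_set_scope.
Local Open Scope ring_scope.

(* The averaged iterate moves by [- eta_t * sum_k p_k g_k], whether or not the
   devices synchronize. Splitting [g_k] into the exact local gradient and a
   noise term, the exact part contracts the squared distance to [wstar] by
   [1 - mu eta_t], up to a heterogeneity error [6 L eta_t^2 Gamma] and twice the
   weighted variance of the local models. The noise terms are centered given
   the past and uncorrelated across devices, so they contribute
   [eta_t^2 sum_k p_k^2 sigma_k^2]. Since the last synchronization at most
   [E - 1] steps were made, with step sizes at most [2 eta_t], so the variance
   of the local models is at most [4 eta_t^2 (E - 1)^2 G^2]. Hence
   [Delta_{t+1} <= (1 - mu eta_t) Delta_t + eta_t^2 B], which is solved by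
   induction and combined with [F - F^* <= L/2 |w - wstar|^2].

   Up to time [T] everything is a function of finitely many uniform draws, so
   expectations are plain averages over the finite set of outcomes. *)

(** * Inner products, weighted means and quadratic bounds *)

Section EuclideanTheory.
Context {R : realType} {d : nat}.
Implicit Types (u v w : 'rV[R]_d) (a : R).

Lemma dotvC u v : dotv u v = dotv v u.
Proof. by apply: eq_bigr => i _; rewrite mulrC. Qed.

Lemma dotvDl u v w : dotv (u + v) w = dotv u w + dotv v w.
Proof. by rewrite -big_split; apply: eq_bigr => i _; rewrite mxE mulrDl. Qed.

Lemma dotvZl a u v : dotv (a *: u) v = a * dotv u v.
Proof. by rewrite big_distrr; apply: eq_bigr => i _; rewrite mxE /= mulrA. Qed.

Lemma dotvDr u v w : dotv u (v + w) = dotv u v + dotv u w.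
Proof. by rewrite !(dotvC u) dotvDl. Qed.

Lemma dotvZr a u v : dotv u (a *: v) = a * dotv u v.
Proof. by rewrite !(dotvC u) dotvZl. Qed.

Lemma dotvNl u v : dotv (- u) v = - dotv u v.
Proof. by rewrite -scaleN1r dotvZl mulN1r. Qed.

Lemma dotvNr u v : dotv u (- v) = - dotv u v.
Proof. by rewrite !(dotvC u) dotvNl. Qed.

Lemma dotv0l u : dotv 0 u = 0.
Proof. by rewrite -(scale0r u) dotvZl mul0r. Qed.

Definition dotvE :=
  (dotvDl, dotvDr, dotvNl, dotvNr, dotvZl, dotvZr).

Lemma dotv_suml (I : finType) (f : I -> 'rV[R]_d) u :
  dotv (\sum_i f i) u = \sum_i dotv (f i) u.
Proof. by apply: (big_morph (dotv^~ u)) => [x y|]; rewrite ?dotvDl ?dotv0l. Qed.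

Lemma dotv_sumr (I : finType) (f : I -> 'rV[R]_d) u :
  dotv u (\sum_i f i) = \sum_i dotv u (f i).
Proof. by rewrite dotvC dotv_suml; apply: eq_bigr => i _; rewrite dotvC. Qed.

Lemma dotvv_ge0 u : 0 <= dotv u u.
Proof. by apply: sumr_ge0 => i _; rewrite -expr2 sqr_ge0. Qed.

Lemma enorm_sqr u : enorm u ^+ 2 = dotv u u.
Proof. by rewrite sqr_sqrtr ?dotvv_ge0. Qed.

Lemma dotvv_eq0 u : dotv u u = 0 -> u = 0.
Proof.
move/psumr_eq0P => h; apply/rowP => i; rewrite mxE.
by apply/eqP; rewrite -sqrf_eq0 expr2 h // => j _; rewrite -expr2 sqr_ge0.
Qed.

(** Expansion of [|u + a v|^2 >= 0]. The sign of [a] is free, so inner products get bounded from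
    both sides. *)
Lemma dotv_young a u v :
  - (2 * a * dotv u v) <= dotv u u + a ^+ 2 * dotv v v.
Proof.
have := dotvv_ge0 (u + a *: v); rewrite !dotvE (dotvC v u); lra.
Qed.

(** Cauchy-Schwarz against the all-ones vector, by induction on the number of summands. *)
Lemma dotvv_sum r (f : 'I_r -> 'rV[R]_d) :
  dotv (\sum_i f i) (\sum_i f i) <= r%:R * \sum_i dotv (f i) (f i).
Proof.
elim: r f => [|r IH] f; first by rewrite !big_ord0 dotv0l mulr0.
rewrite !big_ord_recr /= -natr1.
set u := \sum_(i < r) _; set v := f ord_max.
have {IH} := IH (fun i => f (widen_ord (leqnSn r) i)); rewrite -/u.
set s := \sum_(i < r) _ => IH.
have s0 : 0 <= s by apply: sumr_ge0 => i _; apply: dotvv_ge0.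
have [r0|r0] := eqVneq r 0%N.
  subst r; rewrite /u /s !big_ord0 !(add0r, mul1r, mulr0n); exact: lexx.
have rp : 0 < r%:R :> R by rewrite ltr0n lt0n.
have := dotv_young (- r%:R) u v.
rewrite !dotvE (dotvC v u) => Y.
have := dotvv_ge0 v.
move: (dotv u u) (dotv v v) (dotv u v) r%:R rp IH Y => a b c q rp IH Y b0.
(* [Y] and the induction hypothesis give [2 q c <= q s + q^2 b]; dividing by [q] is why [r = 0] was
   treated apart. *)
have : 2 * c <= s + q * b.
  rewrite -(ler_pM2l rp); nra.
lra.
Qed.

Section Weighted.
Variables (N : nat) (p : 'I_N -> R).
Hypothesis p1 : \sum_(k < N) p k = 1.

(** Bias-variance decomposition: the cross term vanishes because the weighted deviations from the
    mean sum to zero. *)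
Lemma weighted_dotvv (u : 'I_N -> 'rV[R]_d) c :
  \sum_(k < N) p k * dotv (u k - c) (u k - c) =
  \sum_(k < N) p k * dotv (u k - \sum_(l < N) p l *: u l)
                          (u k - \sum_(l < N) p l *: u l)
  + dotv (\sum_(l < N) p l *: u l - c) (\sum_(l < N) p l *: u l - c).
Proof.
set b := \sum_(l < N) p l *: u l.
have e k : p k * dotv (u k - c) (u k - c) =
    p k * dotv (u k - b) (u k - b) + p k * dotv (b - c) (b - c)
    + 2 * dotv (p k *: u k - p k *: b) (b - c).
  rewrite -[u k - c](subrKA b) !dotvE !(dotvC b) !(dotvC c); ring.
under eq_bigr do rewrite e.
rewrite !big_split /= -mulr_suml p1 mul1r -mulr_sumr -dotv_suml.
rewrite sumrB -scaler_suml p1 scale1r.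
by rewrite -/b subrr dotv0l mulr0 addr0.
Qed.

Hypothesis p0 : forall k, 0 <= p k.

Lemma dotvv_weighted_mean_le (u : 'I_N -> 'rV[R]_d) :
  dotv (\sum_(l < N) p l *: u l) (\sum_(l < N) p l *: u l) <=
  \sum_(k < N) p k * dotv (u k) (u k).
Proof.
have := weighted_dotvv u 0; rewrite subr0.
under eq_bigr do rewrite subr0.
move->; rewrite lerDr.
by apply: sumr_ge0 => k _; rewrite mulr_ge0 ?dotvv_ge0.
Qed.

Lemma weighted_variance_le (u : 'I_N -> 'rV[R]_d) c :
  \sum_(k < N) p k * dotv (u k - \sum_(l < N) p l *: u l)
                          (u k - \sum_(l < N) p l *: u l) <=
  \sum_(k < N) p k * dotv (u k - c) (u k - c).
Proof. by rewrite (weighted_dotvv u c) lerDl dotvv_ge0. Qed.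

End Weighted.

(** A gradient step of length [1/L] lowers [f] by at least [|g|^2 / (2 L)], yet cannot go below
    [m]. *)
Lemma smooth_gradient_le (L : R) (f : 'rV[R]_d -> R) (m : R) w :
  0 < L -> smooth L f -> (forall v, m <= f v) ->
  dotv (gradient f w) (gradient f w) <= 2 * L * (f w - m).
Proof.
move=> L0 sm fm; set g := gradient f w.
have := le_trans (fm _) (sm (w - L^-1 *: g) w).
have -> : w - L^-1 *: g - w = - (L^-1 *: g) by rewrite addrAC subrr add0r.
rewrite enorm_sqr -/g !dotvE.
set q := dotv g g => h.
have Li : L * L^-1 = 1 by rewrite divff // gt_eqF.
have : 0 <= f w - m - L^-1 * q / 2.
  suff : L / 2 * - (L^-1 * - (L^-1 * q)) = L^-1 * q / 2 by move: h; lra.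
  transitivity ((L * L^-1) * L^-1 * q / 2); [ring | by rewrite Li; ring].
rewrite -(pmulr_rge0 _ L0) => {}h.
have -> : q = L * L^-1 * q by rewrite Li mul1r.
lra.
Qed.

(** The upper and lower quadratic bounds around 0 share their affine part; at a unit vector only
    [mu / 2] and [L / 2] remain to be compared. *)
Lemma smooth_convex_le (L mu : R) (f : 'rV[R]_d -> R) :
  (0 < d)%N -> smooth L f -> strongly_convex mu f -> mu <= L.
Proof.
move=> hd sm sc; pose e : 'rV[R]_d := delta_mx 0 (Ordinal hd).
have := le_trans (sc e 0) (sm e 0).
have -> : enorm (e - 0) ^+ 2 = 1.
  rewrite enorm_sqr subr0 /dotv (bigD1 (Ordinal hd)) //= !mxE !eqxx mulr1.
  by rewrite big1 ?addr0 // => i ni; rewrite !mxE (negbTE ni) andbF mulr0.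
lra.
Qed.

End EuclideanTheory.

(** * Unbiasedness of the stochastic gradients *)

Section Gradients.
Context {R : realType} {d : nat} {D : Type}.
Variable loss : 'rV[R]_d -> D -> R.
Hypothesis hloss :
  forall (z : D) (w : 'rV[R]_d), differentiable (fun u => loss u z) w.

Lemma gradient_local_objective (m : nat) (x : 'I_m -> D) w :
  gradient (local_objective loss x) w =
  m%:R^-1 *: \sum_(j < m) stochastic_gradient loss w (x j).
Proof.
apply/rowP => i; rewrite !mxE summxE.
have h j : derivable (fun u => loss u (x j)) w (delta_mx 0 i).
  exact: diff_derivable.
have -> : local_objective loss x =
    m%:R^-1 \*: (\sum_(j < m) (fun u => loss u (x j))).
  by apply/funext => u; rewrite /local_objective fct_sumE.
rewrite deriveZ; last exact: derivable_sum.
rewrite derive_sum //; congr (_ * _).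
by apply: eq_bigr => j _; rewrite mxE.
Qed.

(** The noise of a uniform draw is centered at a fixed point [w]; the mean over the draw is written
    as a plain sum. *)
Lemma sum_gradient_noise (m : nat) (x : 'I_m -> D) w : (0 < m)%N ->
  \sum_(j < m) (stochastic_gradient loss w (x j)
                - gradient (local_objective loss x) w) = 0.
Proof.
move=> m0; rewrite sumrB sumr_const card_ord gradient_local_objective.
by rewrite -scaler_nat scalerA divff ?scale1r ?subrr // pnatr_eq0 -lt0n.
Qed.

End Gradients.

(** * One deterministic step with exact local gradients *)

Section Descent.
Context {R : realType} {d N : nat}.
Variables (p : 'I_N -> R) (F : 'I_N -> 'rV[R]_d -> R) (Fmin : 'I_N -> R).
Variables (L mu : R) (wstar : 'rV[R]_d).
Hypotheses (p0 : forall k, 0 <= p k) (p1 : \sum_(k < N) p k = 1).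
Hypotheses (L0 : 0 < L) (mu0 : 0 < mu).
Hypothesis F_smooth : forall k, smooth L (F k).
Hypothesis F_convex : forall k, strongly_convex mu (F k).
Hypothesis Fmin_le : forall k v, Fmin k <= F k v.
Hypothesis wstar_min : is_minimizer (global_objective p F) wstar.

Local Notation Fglob := (global_objective p F).
Local Notation Gamma := (Fglob wstar - \sum_(k < N) p k * Fmin k).

Lemma heterogeneity_ge0 : 0 <= Gamma.
Proof. by rewrite subr_ge0; apply: ler_sum => k _; rewrite ler_wpM2l. Qed.

Lemma global_quadratic_upper v w :
  Fglob v <= Fglob w + dotv (v - w) (\sum_(k < N) p k *: gradient (F k) w)
             + L / 2 * dotv (v - w) (v - w).
Proof.
have -> : L / 2 * dotv (v - w) (v - w)
          = \sum_(k < N) p k * (L / 2 * dotv (v - w) (v - w)).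
  by rewrite -mulr_suml p1 mul1r.
rewrite dotv_sumr -!big_split /=.
apply: ler_sum => k _.
rewrite dotvZr -!mulrDr ler_wpM2l // -enorm_sqr. exact: F_smooth.
Qed.

(* A gradient step of length 1/L from the minimizer would decrease the
   objective, so no differential calculus at [wstar] is needed. *)
Lemma global_gradient_eq0 : \sum_(k < N) p k *: gradient (F k) wstar = 0.
Proof.
set h := \sum_(k < N) _; apply: dotvv_eq0.
have := le_trans (wstar_min (wstar - L^-1 *: h)) (global_quadratic_upper _ wstar).
have -> : wstar - L^-1 *: h - wstar = - (L^-1 *: h).
  by rewrite addrAC subrr add0r.
rewrite -/h !dotvE.
set q := dotv h h => hq.
have q0 : 0 <= q by apply: dotvv_ge0.
have Li : L * L^-1 = 1 by rewrite divff // gt_eqF.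
have e : L / 2 * - (L^-1 * - (L^-1 * q)) = L^-1 * q / 2.
  transitivity ((L * L^-1) * L^-1 * q / 2); [ring | by rewrite Li; ring].
have : L^-1 * q <= 0 by move: hq e; lra.
rewrite pmulr_rle0 ?invr_gt0 // => ?; apply/eqP; rewrite eq_le; lra.
Qed.

Lemma global_gap_le v :
  Fglob v - Fglob wstar <= L / 2 * dotv (v - wstar) (v - wstar).
Proof.
have := global_quadratic_upper v wstar.
by rewrite global_gradient_eq0 dotvC dotv0l addr0 lerBlDl.
Qed.

(** In the expanded square the cross term is [Y - X]: strong convexity bounds [Y] below and produces
    the contraction, Young's inequality bounds [X], and smoothness turns gradient norms into gaps of
    function values. *)
Lemma descent_step (eta : R) (w : 'I_N -> 'rV[R]_d) (wb gb : 'rV[R]_d) :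
  0 < eta -> eta * L <= 4^-1 ->
  wb = \sum_(k < N) p k *: w k ->
  gb = \sum_(k < N) p k *: gradient (F k) (w k) ->
  dotv (wb - wstar - eta *: gb) (wb - wstar - eta *: gb)
  <= (1 - mu * eta) * dotv (wb - wstar) (wb - wstar)
    + 6 * L * eta ^+ 2 * Gamma
    + 2 * \sum_(k < N) p k * dotv (w k - wb) (w k - wb).
Proof.
move=> eta0 etaL wbE gbE.
set A := dotv (wb - wstar) (wb - wstar).
set S := \sum_(k < N) p k * dotv _ _.
set Fs := Fglob wstar; set m := \sum_(k < N) p k * Fmin k.
pose b := \sum_(k < N) p k * F k (w k).
pose c := Fglob wb.
pose H := \sum_(k < N) p k * dotv (gradient (F k) (w k)) (gradient (F k) (w k)).
pose V := \sum_(k < N) p k * dotv (w k - wstar) (w k - wstar).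
pose X := \sum_(k < N) p k * dotv (w k - wb) (gradient (F k) (w k)).
pose Y := \sum_(k < N) p k * dotv (w k - wstar) (gradient (F k) (w k)).
have VE : V = S + A by rewrite /S /A wbE; apply: weighted_dotvv.
have S0 : 0 <= S by apply: sumr_ge0 => k _; rewrite mulr_ge0 ?dotvv_ge0.
have gbH : dotv gb gb <= H by rewrite gbE; apply: dotvv_weighted_mean_le.
have HL : H <= 2 * L * (b - m).
  rewrite -sumrB mulr_sumr; apply: ler_sum => k _.
  rewrite -mulrBr mulrCA ler_wpM2l //; exact: smooth_gradient_le.
have XY : dotv (wb - wstar) gb = Y - X.
  rewrite gbE dotv_sumr -sumrB; apply: eq_bigr => k _.
  by rewrite dotvZr -mulrBr !dotvE; congr (_ * _); ring.
have XS : 2 * eta * X <= S + eta ^+ 2 * H.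
  rewrite !mulr_sumr -big_split; apply: ler_sum => k _ /=.
  rewrite mulrCA [eta ^+ 2 * _]mulrCA -mulrDr ler_wpM2l //.
  have := dotv_young (- eta) (w k - wb) (gradient (F k) (w k)).
  by rewrite sqrrN mulrN mulNr opprK.
have YF : b - Fs + mu / 2 * V <= Y.
  rewrite -sumrB mulr_sumr -big_split; apply: ler_sum => k _ /=.
  rewrite [mu / 2 * _]mulrCA -mulrBr -mulrDr ler_wpM2l //.
  have := F_convex k wstar (w k).
  rewrite enorm_sqr -(opprB (w k)) !dotvNl dotvNr; lra.
(* Compares values at the local models with values at their mean: convexity around [wb], Young's
   inequality with weight [eta], and the smooth gradient bound at [wb]. *)
have bc : 2 * eta * c - S - 2 * L * eta ^+ 2 * (c - m) <= 2 * eta * b.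
  rewrite -[c - m]sumrB !mulr_sumr -!sumrB; apply: ler_sum => k _ /=.
  rewrite -mulrBr [2 * eta * (_ * _)]mulrCA [2 * L * _ * _]mulrCA.
  rewrite [2 * eta * (_ * F k (w k))]mulrCA -!mulrBr ler_wpM2l //.
  have := F_convex k (w k) wb.
  have := dotv_young eta (w k - wb) (gradient (F k) wb).
  have := smooth_gradient_le L (F k) (Fmin k) wb L0 (F_smooth k) (Fmin_le k).
  rewrite enorm_sqr.
  have := dotvv_ge0 (w k - wb).
  set q := dotv (gradient _ _) _; set r := dotv (w k - wb) (gradient _ _).
  set s := dotv (w k - wb) (w k - wb).
  move=> s0 hq hr hF.
  have h1 : eta * (F k wb + r) <= eta * F k (w k).
    by rewrite ler_pM2l // (le_trans _ hF) // lerDl mulr_ge0 // ltW ?divr_gt0.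
  have h2 : eta ^+ 2 * q <= eta ^+ 2 * (2 * L * (F k wb - Fmin k)).
    by rewrite ler_wpM2l ?sqr_ge0.
  lra.
have cFs : 0 <= c - Fs by rewrite subr_ge0; exact: wstar_min.
have G0 : 0 <= Fs - m by exact: heterogeneity_ge0.
have -> : dotv (wb - wstar - eta *: gb) (wb - wstar - eta *: gb) =
    A - 2 * eta * (Y - X) + eta ^+ 2 * dotv gb gb.
  rewrite -XY /A; move: (wb - wstar) => U.
  by rewrite !dotvE (dotvC gb U); ring.
clear XY; move: VE S0 gbH HL XS YF bc cFs G0.
move: (dotv gb gb) @A @S @Fs @m @b @c @H @V @X @Y.
move=> g A S Fs m b c H V X Y -> S0 gbH HL XS YF bc cFs G0.
have e2 : 0 <= eta ^+ 2 by apply: sqr_ge0.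
have h1 : eta ^+ 2 * g <= eta ^+ 2 * H by rewrite ler_wpM2l.
have h2 : eta ^+ 2 * H <= eta ^+ 2 * (2 * L * (b - m)) by rewrite ler_wpM2l.
have h3 : eta * (b - Fs + mu / 2 * (S + A)) <= eta * Y by rewrite ler_pM2l.
have h4 : 0 <= mu * eta * S by rewrite !mulr_ge0 // ltW.
(* What remains is [- 2 eta (1 - 2 q) (b - Fs)], where [b] may lie below [Fs]. Scaling [bc] by
   [1 - 2 q >= 0] replaces [b] by [c >= Fs]. The constant 6 is 4 from the gradient norms plus 2 from
   this replacement. *)
pose q := eta * L.
have q0 : 0 <= q by rewrite mulr_ge0 // ltW.
have h5 : 0 <= eta * (c - Fs) by rewrite mulr_ge0 // ltW.
have h6 : 0 <= eta * (Fs - m) by rewrite mulr_ge0 // ltW.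
have q4 : 0 <= 1 - 2 * q by rewrite /q; lra.
have bc' : (1 - 2 * q) * (2 * eta * (c - Fs) - S - 2 * q * (eta * (c - m)))
           <= (1 - 2 * q) * (2 * eta * (b - Fs)).
  by rewrite ler_wpM2l // /q; lra.
have h7 : 0 <= (1 - 2 * q) * (1 - q) * (eta * (c - Fs)).
  by rewrite !mulr_ge0 // /q; lra.
have h8 : 0 <= q * S by rewrite mulr_ge0.
have h9 : 0 <= q ^+ 2 * (eta * (Fs - m)) by rewrite mulr_ge0 ?sqr_ge0.
move: bc' h7 h8 h9; rewrite /q => bc' h7 h8 h9.
lra.
Qed.

End Descent.

(** * Expectation over a finite uniform space *)

Section FiniteAverage.
Context {R : realType} {S : finType}.
Implicit Types f g : S -> R.

Definition avg f : R := #|S|%:R^-1 * \sum_a f a.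

Lemma avgD f g : avg (fun a => f a + g a) = avg f + avg g.
Proof. by rewrite /avg big_split mulrDr. Qed.

Lemma avgZ c f : avg (fun a => c * f a) = c * avg f.
Proof. by rewrite /avg -mulr_sumr mulrCA. Qed.

Lemma avg_sum (I : finType) (f : I -> S -> R) :
  avg (fun a => \sum_i f i a) = \sum_i avg (f i).
Proof. by rewrite /avg exchange_big mulr_sumr. Qed.

Lemma eq_avg f g : f =1 g -> avg f = avg g.
Proof. by move=> fg; congr (_ * _); apply: eq_bigr. Qed.

Lemma le_avg f g : (forall a, f a <= g a) -> avg f <= avg g.
Proof.
by move=> fg; rewrite ler_wpM2l ?invr_ge0 ?ler0n //; apply: ler_sum.
Qed.

Lemma avg_cst c : (0 < #|S|)%N -> avg (fun=> c) = c.
Proof.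
move=> S0; rewrite /avg sumr_const -[c *+ _]mulr_natl mulKf //.
by rewrite pnatr_eq0 -lt0n.
Qed.

Lemma avg_ge0 f : (forall a, 0 <= f a) -> 0 <= avg f.
Proof. by move=> f0; rewrite mulr_ge0 ?invr_ge0 ?ler0n ?sumr_ge0. Qed.

End FiniteAverage.

(** * Resampling a single coordinate *)

Section Resampling.
Context {R : realType} {J : finType} (m : J -> nat).

Local Notation outcome := {dffun forall j : J, 'I_(m j)}.

Definition resample (a : outcome) (j : J) (i : 'I_(m j)) : outcome :=
  [ffun j' => dfwith a j i j'].

Lemma resample_same a j i : resample a j i j = i.
Proof. by rewrite ffunE dfwithin. Qed.

Lemma resample_other a j i j' : j != j' -> resample a j i j' = a j'.
Proof. by move=> ne; rewrite ffunE dfwithout. Qed.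

Lemma resampleK a j i : resample (resample a j i) j (a j) = a.
Proof.
apply/ffunP => j'; have [<-|ne] := eqVneq j j'; first by rewrite resample_same.
by rewrite !resample_other.
Qed.

(* Swapping the coordinate [j] of an outcome with an independent copy of it is
   an involution, hence preserves the uniform distribution. *)
Lemma avg_resample_eq0 (j : J) (f : outcome -> R) : (0 < m j)%N ->
  (forall a, \sum_(i < m j) f (resample a j i) = 0) -> avg f = 0.
Proof.
move=> mj f0; rewrite /avg; suff -> : \sum_a f a = 0 by rewrite mulr0.
have : (m j)%:R * \sum_a f a = 0.
  transitivity (\sum_(a : outcome) \sum_(i < m j) f a).
    rewrite mulr_sumr; apply: eq_bigr => a _.
    by rewrite sumr_const card_ord mulr_natl.
  rewrite pair_bigA /=.
  pose h (q : outcome * 'I_(m j)) := (resample q.1 j q.2, q.1 j).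
  have hK : cancel h h by case=> a i; rewrite /h /= resampleK resample_same.
  rewrite (reindex_inj (can_inj hK)) -(pair_bigA _ (fun a i => f (resample a j i))).
  by rewrite big1.
by move/eqP; rewrite mulf_eq0 pnatr_eq0 eqn0Ngt mj => /eqP.
Qed.

End Resampling.

(** * Transfer from the probability space to finite averages *)

Section UniformOutcomes.
Context {disp : measure_display} {Omega : measurableType disp} {R : realType}.
Variable P : probability Omega R.
Variables (J : finType) (m : J -> nat) (X : forall j, Omega -> 'I_(m j)).

Local Notation outcome := {dffun forall j : J, 'I_(m j)}.

Hypothesis X_meas : forall j, discrete_rv (X j).
Hypothesis X_unif : forall a : outcome,
  P (\bigcap_j (X j @^-1` [set a j])) = (\prod_j (m j)%:R^-1)%:E.

Lemma card_outcome : #|outcome| = (\prod_j m j)%N.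
Proof.
rewrite card_dep_ffun foldrE big_map big_enum.
by apply: eq_bigr => j _; rewrite card_ord.
Qed.

(** The random variable is a finite combination of indicators of the cylinders [B a], each of
    probability one over the number of outcomes. *)
Lemma expectation_outcome (f : outcome -> R) :
  'E_P[fun omega => f [ffun j => X j omega]]%E = (avg f)%:E.
Proof.
pose B (a : outcome) := \bigcap_j (X j @^-1` [set a j]).
have mB a : measurable (B a).
  apply: fin_bigcap_measurable => // j _; exact: X_meas.
rewrite unlock.
transitivity (\int[P]_omega (\sum_a (f a)%:E * (\1_(B a) omega)%:E))%E.
  apply: eq_integral => omega _; rewrite (bigD1 ([ffun j => X j omega] : outcome)) //=.
  rewrite big1 => [|a ne].
    rewrite adde0 indicE mem_set ?mule1 // => j _ /=.
    by rewrite ffunE.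
  rewrite indicE memNset ?mule0 // => h; move/eqP: ne; apply.
  by apply/ffunP => j; rewrite ffunE (h j).
rewrite integral_sum //; last first.
  move=> a; apply: integrableZl => //; exact: integrable_indic.
rewrite /avg mulr_sumr -sumEFin; apply: eq_bigr => a _.
rewrite integralZl //; last exact: integrable_indic.
rewrite integral_indic // setIT.
transitivity ((f a)%:E * (\prod_j (m j)%:R^-1)%:E)%E.
  by congr (_ * _)%E; exact: X_unif.
by rewrite card_outcome natr_prod -prodfV -EFinM mulrC.
Qed.

End UniformOutcomes.

(** Extracts a finite subfamily of a possibly infinite independent family; injectivity of [h] makes
    the list of selected indices duplicate-free. *)
Lemma uniform_independent_cylinder {disp : measure_display}
    {Omega : measurableType disp} {R : realType} (P : probability Omega R)
    (K : eqType) (m : K -> nat) (xi : forall k, Omega -> 'I_(m k))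
    (J : finType) (h : J -> K) (a : forall j, 'I_(m (h j))) :
  injective h -> (forall k, uniform_rv P (xi k)) -> mutually_independent P xi ->
  P (\bigcap_j (xi (h j) @^-1` [set a j])) = (\prod_j (m (h j))%:R^-1)%:E.
Proof.
move=> h_inj unif indep.
(* Comparing values in [nat] avoids a transport along [h j = k]. *)
pose A k : set 'I_(m k) := [set i | forall j, h j = k -> i = a j :> nat].
have AE j : A (h j) = [set a j].
  apply/seteqP; split=> [i /(_ j erefl)/val_inj //|_ -> j' /h_inj -> //].
have uniq_h : uniq (map h (enum J)) by rewrite map_inj_uniq ?enum_uniq.
transitivity (P (\bigcap_(k in [set` map h (enum J)]) (xi k @^-1` A k))).
  congr (P _); apply/seteqP; split=> [w hw _ /= /mapP[j _ ->]|w hw j _].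
    by rewrite AE; apply: hw.
  by rewrite -AE; apply: hw; rewrite /= map_f ?mem_enum.
rewrite indep // big_map big_enum -prodEFin; apply: eq_bigr => j _.
by rewrite AE; apply: unif.
Qed.

(** * Individual runs: causality, averaging and drift *)

Section Runs.
Context {R : realType} {d N : nat} {D : Type}.
Variables (loss : 'rV[R]_d -> D -> R) (p : 'I_N -> R) (eta : nat -> R).
Variables (E : nat) (w0 : 'rV[R]_d).
Hypotheses (p0 : forall k, 0 <= p k) (p1 : \sum_(k < N) p k = 1).
Hypothesis E_gt0 : (0 < E)%N.
Implicit Types z : nat -> 'I_N -> D.

Local Notation local := (local_model loss p eta E w0).
Local Notation average := (average_model loss p eta E w0).
Local Notation sgrad z t k := (stochastic_gradient loss (local z t k) (z t k)).

(** Causality: the models at step [t] use only earlier draws, so the draw at step [t] can be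
    resampled without changing them. *)
Lemma local_model_eq z z' t k :
  (forall s l, (s < t)%N -> z s l = z' s l) -> local z t k = local z' t k.
Proof.
elim: t k => [//|t IH] k h /=.
have e l : local z t l = local z' t l by apply: IH => s l' st; apply/h/ltnW.
have ev l : local z t l - eta t *: sgrad z t l
          = local z' t l - eta t *: sgrad z' t l by rewrite e h.
by case: (E %| t.+1)%N; [apply: eq_bigr => l _; rewrite ev | exact: ev].
Qed.

(** Synchronization replaces every model by the weighted mean, which leaves that mean unchanged
    since the weights sum to one. *)
Lemma average_modelS z t :
  average z t.+1 = average z t - eta t *: \sum_(k < N) p k *: sgrad z t k.
Proof.
have e : \sum_(k < N) p k *: (local z t k - eta t *: sgrad z t k) =
    average z t - eta t *: \sum_(k < N) p k *: sgrad z t k.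
  rewrite scaler_sumr -sumrB; apply: eq_bigr => k _.
  by rewrite scalerBr !scalerA mulrC.
rewrite -e /average_model /=; case: ifP => // _.
by rewrite -scaler_suml p1 scale1r.
Qed.

Lemma local_model_sync z q k l : local z (q * E) k = local z (q * E) l.
Proof.
(* Time 0 is not a synchronization step; there the models agree because all start from [w0]. *)
case: q => [//|q]; have := dvdn_mull q.+1 (dvdnn E).
have : (0 < q.+1 * E)%N by rewrite muln_gt0.
by case: (q.+1 * E)%N => // t _ /= ->.
Qed.

Lemma local_model_round z q r k : (r < E)%N ->
  local z (q * E + r) k =
  local z (q * E) k
  - \sum_(s < r) eta (q * E + s) *: sgrad z (q * E + s) k.
Proof.
elim: r => [|r IH] rE; first by rewrite addn0 big_ord0 subr0.
rewrite addnS /= ifF; last first.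
  rewrite -addnS dvdn_addr ?dvdn_mull //.
  by apply/negbTE/negP => /dvdn_leq => /(_ isT); rewrite leqNgt rE.
by rewrite IH ?(ltnW rE) // big_ord_recr /= opprD addrA -IH ?(ltnW rE).
Qed.

(** The spread about the mean is at most the spread about the common model at the start of the
    round; Cauchy-Schwarz over the [r] local steps since then does the rest. *)
Lemma drift_le z q r : (r < E)%N ->
  \sum_(k < N) p k * dotv (local z (q * E + r) k - average z (q * E + r))
                          (local z (q * E + r) k - average z (q * E + r))
  <= r%:R * \sum_(k < N) p k * \sum_(s < r) eta (q * E + s) ^+ 2
       * dotv (sgrad z (q * E + s) k) (sgrad z (q * E + s) k).
Proof.
move=> rE.
have [k0 _|N0] := pickP 'I_N; last first.
  by rewrite !big1 ?mulr0 // => k; have := N0 k.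
apply: (le_trans (weighted_variance_le _ _ p1 _ (local z (q * E) k0))).
rewrite mulr_sumr; apply: ler_sum => k _; rewrite [leRHS]mulrCA ler_wpM2l //.
rewrite (local_model_sync _ _ k0 k) local_model_round // addrAC subrr add0r.
rewrite dotvNl dotvNr opprK (le_trans (dotvv_sum _ _)) // ler_wpM2l ?ler0n //.
by apply: ler_sum => s _; rewrite dotvZl dotvZr mulrA -expr2.
Qed.

End Runs.

(** * The descent recursion in expectation *)

Section ExpectedDescent.
Context {R : realType} {d N : nat} {D : Type}.
Variables (loss : 'rV[R]_d -> D -> R) (p : 'I_N -> R) (eta : nat -> R).
Variables (E T : nat) (w0 : 'rV[R]_d).
Variables (n : 'I_N -> nat) (x : forall k, 'I_(n k) -> D).
Hypotheses (p0 : forall k, 0 <= p k) (p1 : \sum_(k < N) p k = 1).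
Hypotheses (E_gt0 : (0 < E)%N) (n_gt0 : forall k, (0 < n k)%N).
Hypothesis hloss :
  forall (z : D) (w : 'rV[R]_d), differentiable (fun u => loss u z) w.

Local Notation F := (fun k => local_objective loss (x k)).
Local Notation outcome := {dffun forall j : 'I_T.+1 * 'I_N, 'I_(n j.2)}.

(* Only meaningful for [t <= T]: [inord] sends larger steps to step 0. *)
Definition drawn (a : outcome) (t : nat) (k : 'I_N) : D :=
  x k (a (inord t, k)).

Local Notation W t k a := (local_model loss p eta E w0 (drawn a) t k).
Local Notation Wbar t a := (average_model loss p eta E w0 (drawn a) t).
Local Notation sgrad t k a := (stochastic_gradient loss (W t k a) (drawn a t k)).
Local Notation noise t k a := (sgrad t k a - gradient (F k) (W t k a)).

Lemma local_model_resample a t k l i : (t <= T)%N ->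
  W t l (resample _ a (inord t, k) i) = W t l a.
Proof.
move=> tT; apply: local_model_eq => s l' st; rewrite /drawn resample_other //.
apply/eqP => -[/(congr1 val)]; rewrite /= !inordK ?ltnS //.
  by move=> ts _; rewrite ts ltnn in st.
exact: leq_trans (ltnW st) tT.
Qed.

Lemma drawn_resample a t k (i : 'I_(n k)) :
  drawn (resample (fun j : 'I_T.+1 * 'I_N => n j.2) a (inord t, k) i) t k = x k i.
Proof. by rewrite /drawn resample_same. Qed.

Lemma average_model_resample a t k i : (t <= T)%N ->
  Wbar t (resample _ a (inord t, k) i) = Wbar t a.
Proof. by move=> tT; apply: eq_bigr => l _; rewrite local_model_resample. Qed.

(** Martingale-difference property: resampling the draw of device [k] at step [t] fixes both [f] and
    the model, and averages the noise to zero. *)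
Lemma avg_noise_eq0 t k (f : outcome -> 'rV[R]_d) : (t <= T)%N ->
  (forall a i, f (resample _ a (inord t, k) i) = f a) ->
  avg (fun a => dotv (f a) (noise t k a)) = 0.
Proof.
move=> tT fE; apply: (avg_resample_eq0 _ (inord t, k)) => [|a]; first exact: n_gt0.
under eq_bigr => i _.
  rewrite fE local_model_resample // drawn_resample; over.
rewrite -dotv_sumr -[X in dotv _ X]/(\sum_(j < n k) _) sum_gradient_noise //.
by rewrite dotvC dotv0l.
Qed.

Lemma noise_resample_other a t k l i : (t <= T)%N -> k != l ->
  noise t l (resample _ a (inord t, k) i) = noise t l a.
Proof.
move=> tT kl; rewrite local_model_resample //.
have -> : drawn (resample _ a (inord t, k) i) t l = drawn a t l.
  rewrite /drawn resample_other //.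
  by apply/eqP => -[kl']; rewrite kl' eqxx in kl.
by [].
Qed.

Variables (sigma : 'I_N -> R) (G : R).
Hypothesis hvariance : forall k t, (t <= T)%N ->
  avg (fun a => dotv (noise t k a) (noise t k a)) <= sigma k ^+ 2.
Hypothesis hbounded : forall k t, (t <= T)%N ->
  avg (fun a => dotv (sgrad t k a) (sgrad t k a)) <= G ^+ 2.

(** Off-diagonal terms vanish, since the noise of one device does not depend on the draw of another
    at the same step. *)
Lemma avg_mean_noise_le t : (t <= T)%N ->
  avg (fun a => dotv (\sum_(k < N) p k *: noise t k a)
                     (\sum_(k < N) p k *: noise t k a))
  <= \sum_(k < N) p k ^+ 2 * sigma k ^+ 2.
Proof.
move=> tT.
have -> : avg (fun a => dotv (\sum_(k < N) p k *: noise t k a)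
                     (\sum_(k < N) p k *: noise t k a)) =
    \sum_(k < N) \sum_(l < N)
      p l * p k * avg (fun a => dotv (noise t l a) (noise t k a)).
  under eq_avg => a do rewrite dotv_sumr.
  rewrite avg_sum; apply: eq_bigr => k _.
  under eq_avg => a do rewrite dotv_suml.
  rewrite avg_sum; apply: eq_bigr => l _.
  by rewrite -avgZ; apply: eq_avg => a; rewrite dotvZl dotvZr mulrA.
apply: ler_sum => k _; rewrite (bigD1 k) //= big1 => [|l lk].
  by rewrite addr0 -expr2 ler_wpM2l ?sqr_ge0 ?hvariance.
rewrite (avg_noise_eq0 t k (fun a => noise t l a) tT) ?mulr0; first by [].
by move=> a i; apply: noise_resample_other; rewrite // eq_sym.
Qed.

(** With [r = t mod E <= E - 1], one factor [E - 1] comes from Cauchy-Schwarz and the other from the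
    number of summands; the 4 is the squared step-size ratio. *)
Lemma avg_drift_le t : (t <= T)%N ->
  (forall s, (t < s + E)%N -> (s <= t)%N -> 0 <= eta s <= 2 * eta t) ->
  avg (fun a => \sum_(k < N) p k * dotv (W t k a - Wbar t a) (W t k a - Wbar t a))
  <= 4 * eta t ^+ 2 * ((E%:R - 1) ^+ 2 * G ^+ 2).
Proof.
move=> tT heta; have rE : (t %% E < E)%N by rewrite ltn_mod.
have tE := divn_eq t E; set q := (t %/ E)%N in tE; set r := (t %% E)%N in tE rE.
rewrite {}tE in tT heta *; set t' := (q * E + r)%N in tT heta *.
have -> : (4 * eta t' ^+ 2 * ((E%:R - 1) ^+ 2 * G ^+ 2)) =
  (E%:R - 1) * \sum_(k < N) p k * ((E%:R - 1) * ((2 * eta t') ^+ 2 * G ^+ 2)).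
  by rewrite -mulr_suml p1; ring.
apply: (le_trans (le_avg _ _ (fun a => drift_le _ _ _ _ _ p0 p1 E_gt0 _ q r rE))).
have rE1 : r%:R <= E%:R - 1 :> R by rewrite lerBrDr natr1 ler_nat.
rewrite avgZ avg_sum ler_pM ?ler0n //.
  apply: sumr_ge0 => k _; apply: avg_ge0 => a; rewrite mulr_ge0 //.
  by apply: sumr_ge0 => s _; rewrite mulr_ge0 ?sqr_ge0 ?dotvv_ge0.
apply: ler_sum => k _; rewrite avgZ ler_wpM2l // avg_sum.
apply: (@le_trans _ _ (\sum_(s < r) ((2 * eta t') ^+ 2 * G ^+ 2))); last first.
  rewrite sumr_const card_ord -[leLHS]mulr_natl ler_wpM2r //.
  by rewrite mulr_ge0 ?sqr_ge0.
apply: ler_sum => s _; rewrite avgZ.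
have sr : (q * E + s <= t')%N by rewrite leq_add2l ltnW.
have /andP[e0 e2] : 0 <= eta (q * E + s) <= 2 * eta t'.
  apply: heta => //; rewrite -addnA ltn_add2l (leq_trans rE) //.
  exact: leq_addl.
rewrite ler_pM ?sqr_ge0 ?hbounded ?(leq_trans sr) //.
  by apply: avg_ge0 => a; apply: dotvv_ge0.
by rewrite lerXn2r // nnegrE (le_trans e0).
Qed.

Variables (Fmin : 'I_N -> R) (L mu : R) (wstar : 'rV[R]_d).
Hypotheses (L0 : 0 < L) (mu0 : 0 < mu).
Hypothesis F_smooth : forall k, smooth L (F k).
Hypothesis F_convex : forall k, strongly_convex mu (F k).
Hypothesis Fmin_le : forall k v, Fmin k <= F k v.
Hypothesis wstar_min : is_minimizer (global_objective p F) wstar.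

Local Notation Gamma :=
  (global_objective p F wstar - \sum_(k < N) p k * Fmin k).

Lemma avg_descent t : (t <= T)%N -> 0 < eta t -> eta t * L <= 4^-1 ->
  (forall s, (t < s + E)%N -> (s <= t)%N -> 0 <= eta s <= 2 * eta t) ->
  avg (fun a => dotv (Wbar t.+1 a - wstar) (Wbar t.+1 a - wstar))
  <= (1 - mu * eta t) * avg (fun a => dotv (Wbar t a - wstar) (Wbar t a - wstar))
     + eta t ^+ 2 * (\sum_(k < N) p k ^+ 2 * sigma k ^+ 2 + 6 * L * Gamma
                     + 8 * (E%:R - 1) ^+ 2 * G ^+ 2).
Proof.
move=> tT eta0 etaL heta.
pose gb (a : outcome) := \sum_(k < N) p k *: gradient (F k) (W t k a).
pose nu (a : outcome) := \sum_(k < N) p k *: noise t k a.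
pose U a := Wbar t a - wstar - eta t *: gb a.
pose S (a : outcome) :=
  \sum_(k < N) p k * dotv (W t k a - Wbar t a) (W t k a - Wbar t a).
have outcome_gt0 : (0 < #|{: outcome}|)%N.
  by rewrite card_outcome prodn_gt0.
have stepE a : Wbar t.+1 a - wstar = U a - eta t *: nu a.
  rewrite average_modelS //.
  have -> : \sum_(k < N) p k *: sgrad t k a = gb a + nu a.
    by rewrite -big_split; apply: eq_bigr => k _; rewrite /= -scalerDr subrKC.
  by rewrite /U scalerDr opprD addrA [LHS]addrAC [in LHS](addrAC (Wbar t a)).
(* [U] depends only on draws before step [t], so it is uncorrelated with the noise of every
   device. *)
have cross : avg (fun a => dotv (U a) (nu a)) = 0.
  under eq_avg => a do rewrite dotv_sumr.
  rewrite avg_sum big1 // => k _.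
  under eq_avg => a do rewrite dotvZr.
  rewrite avgZ (avg_noise_eq0 t k U tT) ?mulr0; first by [].
  move=> a i; rewrite /U (average_model_resample a t k i tT); congr (_ - _ *: _).
  apply: eq_bigr => l _; congr (_ *: gradient _ _).
  exact: local_model_resample.
have -> : avg (fun a => dotv (Wbar t.+1 a - wstar) (Wbar t.+1 a - wstar)) =
    avg (fun a => dotv (U a) (U a)) + eta t ^+ 2 * avg (fun a => dotv (nu a) (nu a)).
  transitivity (avg (fun a => dotv (U a) (U a)
      + (- (2 * eta t) * dotv (U a) (nu a) + eta t ^+ 2 * dotv (nu a) (nu a)))).
    apply: eq_avg => a; rewrite stepE; move: (U a) (nu a) => u v.
    by rewrite !dotvE (dotvC v); ring.
  by rewrite !avgD !avgZ cross mulr0 add0r.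
have hU : avg (fun a => dotv (U a) (U a)) <=
    (1 - mu * eta t) * avg (fun a => dotv (Wbar t a - wstar) (Wbar t a - wstar))
    + 6 * L * eta t ^+ 2 * Gamma + 2 * avg S.
  rewrite -!avgZ -[6 * L * _ * _](avg_cst (S := outcome)) // -!avgD.
  by apply: le_avg => a; exact: descent_step.
(* The factor 2 before [avg S] times the 4 of the drift bound gives the 8 in the constant. *)
have := avg_drift_le t tT heta; rewrite -/S => hS.
have hnu : eta t ^+ 2 * avg (fun a => dotv (nu a) (nu a)) <=
    eta t ^+ 2 * \sum_(k < N) p k ^+ 2 * sigma k ^+ 2.
  by rewrite ler_wpM2l ?sqr_ge0 // avg_mean_noise_le.
move: hU hS hnu.
move: (avg _) (avg _) (avg _) (avg S) (\sum_(k < N) _ ^+ 2 * _) Gamma.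
move=> a1 a2 a3 a4 sg Gm; lra.
Qed.

End ExpectedDescent.

(** With [s = gamma + t], the bound [v / (s - 1)] propagates to [v / s]: since [4 B / mu^2 <= v],
    the slack is at least [v / (s^2 (s - 1))]. Starting at [t = 1] makes the first denominator
    exactly [gamma]. *)
Lemma harmonic_decay {R : realType} (mu gamma B : R) (T : nat) (delta : nat -> R) :
  0 < mu -> 1 <= gamma -> 0 <= B -> 0 <= delta 1%N ->
  (forall t, (1 <= t < T)%N ->
     delta t.+1 <= (1 - mu * (2 / (mu * (gamma + t%:R)))) * delta t
                   + (2 / (mu * (gamma + t%:R))) ^+ 2 * B) ->
  forall t, (1 <= t <= T)%N ->
  delta t <= (4 * B / mu ^+ 2 + gamma * delta 1%N) / (gamma + t%:R - 1).
Proof.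
move=> mu0 g1 B0 d0 step; set v := 4 * B / _ + _.
have mu2 : 0 < mu ^+ 2 by rewrite exprn_gt0.
have b0 : 0 <= 4 * B / mu ^+ 2 by rewrite divr_ge0 ?(ltW mu2) // mulr_ge0.
elim=> // t IH /andP[_ tT].
have [->|t0] := posnP t.
  by rewrite addrK ler_pdivlMr ?(lt_le_trans _ g1) // mulrC /v lerDr.
apply: (le_trans (step t _)); first by rewrite t0.
have {IH} := IH; rewrite t0 (ltnW tT) => /(_ isT).
have t1 : 1 <= t%:R :> R by rewrite ler1n.
rewrite -[t.+1%:R]natr1 [gamma + (_ + 1)]addrA addrK.
(* Keeps the contraction factor [(s - 2) / s] nonnegative, so the induction hypothesis can be
   multiplied by it. *)
have : gamma + t%:R >= 2 by lra.
move: (gamma + t%:R) (delta t) => s e s2 IH.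
have s0 : 0 < s by lra.
have s10 : 0 < s - 1 by lra.
have -> : 1 - mu * (2 / (mu * s)) = (s - 2) / s.
  by field; rewrite !gt_eqF.
have -> : (2 / (mu * s)) ^+ 2 * B = 4 * B / mu ^+ 2 / s ^+ 2.
  by field; rewrite !gt_eqF.
have bv : 4 * B / mu ^+ 2 <= v.
  by rewrite /v lerDl mulr_ge0 // (le_trans _ g1).
move: (4 * B / mu ^+ 2) v b0 bv IH => b v b0 bv IH {step}.
apply: (@le_trans _ _ ((s - 2) / s * (v / (s - 1)) + v / s ^+ 2)).
  apply: lerD; last by rewrite ler_pM2r // invr_gt0 exprn_gt0.
  by rewrite ler_wpM2l // divr_ge0 ?(ltW s0) //; lra.
rewrite -subr_ge0.
have -> : v / s - ((s - 2) / s * (v / (s - 1)) + v / s ^+ 2) =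
   v / (s ^+ 2 * (s - 1)).
  by field; rewrite !gt_eqF.
apply: divr_ge0; first exact: le_trans b0 bv.
by apply: mulr_ge0; [exact: sqr_ge0 | exact: ltW].
Qed.

(** * Checking the step sizes and assembling the bound *)

Theorem theorem1
  (R : realType) (disp : measure_display) (Omega : measurableType disp)
  (P : probability Omega R)
  (d : nat) (hd : (0 < d)%N)
  (* the devices, their weights and their data *)
  (N : nat) (p : 'I_N -> R)
  (hp : forall k, 0 <= p k) (hp1 : \sum_(k < N) p k = 1)
  (D : Type) (n : 'I_N -> nat) (hn : forall k, (0 < n k)%N)
  (x : forall k, 'I_(n k) -> D)
  (* the loss and the objectives *)
  (loss : 'rV[R]_d -> D -> R)
  (hloss : forall (z : D) (w : 'rV[R]_d), differentiable (fun u => loss u z) w)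
  (Fl : 'I_N -> 'rV[R]_d -> R)
  (hFl : forall k, Fl k = local_objective loss (x k))
  (F : 'rV[R]_d -> R) (hF : F = global_objective p Fl)
  (wstar : 'rV[R]_d) (hwstar : is_minimizer F wstar)
  (Flstar : 'I_N -> R) (hFlstar : forall k, is_minimum (Fl k) (Flstar k))
  (Gamma : R) (hGamma : Gamma = F wstar - \sum_(k < N) p k * Flstar k)
  (* the sampling: [xi (t, k)] is the index of the data point drawn by device
     [k] at step [t] *)
  (xi : forall tk : nat * 'I_N, Omega -> 'I_(n tk.2))
  (hxi_meas : forall tk, discrete_rv (xi tk))
  (hxi_unif : forall tk, uniform_rv P (xi tk))
  (hxi_indep : mutually_independent P xi)
  (* the parameters and the learning rate *)
  (E T : nat) (hE : (1 <= E)%N) (hT : (1 <= T)%N) (hET : (E %| T)%N)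
  (L mu G : R) (sigma : 'I_N -> R) (hmu : 0 < mu)
  (kappa gamma : R) (hkappa : kappa = L / mu)
  (hgamma : gamma = Num.max (8 * kappa) E%:R)
  (eta : nat -> R) (heta : forall t, eta t = 2 / (mu * (gamma + t%:R)))
  (* the algorithm *)
  (w0 : 'rV[R]_d)
  (data : Omega -> nat -> 'I_N -> D)
  (hdata : forall omega t k, data omega t k = x k (xi (t, k) omega))
  (wl : nat -> 'I_N -> Omega -> 'rV[R]_d)
  (hwl : forall t k omega,
     wl t k omega = local_model loss p eta E w0 (data omega) t k)
  (wbar : nat -> Omega -> 'rV[R]_d)
  (hwbar : forall t omega,
     wbar t omega = average_model loss p eta E w0 (data omega) t)
  (* assumptions (1)-(4) *)
  (hsmooth : forall k, smooth L (Fl k))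
  (hconvex : forall k, strongly_convex mu (Fl k))
  (hvariance : forall k t, (t < T)%N ->
     ('E_P[fun omega => (enorm
         (stochastic_gradient loss (wl t k omega) (data omega t k)
          - gradient (Fl k) (wl t k omega)) ^+ 2)%R]
      <= (sigma k ^+ 2)%:E)%E)
  (hbounded : forall k t, (t < T)%N ->
     ('E_P[fun omega => (enorm
         (stochastic_gradient loss (wl t k omega) (data omega t k)) ^+ 2)%R]
      <= (G ^+ 2)%:E)%E)
  (B : R)
  (hB : B = \sum_(k < N) p k ^+ 2 * sigma k ^+ 2 + 6 * L * Gamma
            + 8 * (E%:R - 1) ^+ 2 * G ^+ 2) :
  ('E_P[fun omega => F (wbar T omega)] - (F wstar)%:E
   <= (kappa / (gamma + T%:R - 1))%:E
      * ((2 * B / mu)%:E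
         + (mu * gamma / 2)%:E
           * 'E_P[fun omega => (enorm (wbar 1%N omega - wstar) ^+ 2)%R]))%E.
Proof.
case: T hT hET hvariance hbounded => // T' _ _ hvariance hbounded.
have {hFl}FlE : Fl = (fun k => local_objective loss (x k)) by exact/funext.
subst F Fl gamma kappa.
set gamma := Num.max _ _ in heta *.
have Fl_min k v : Flstar k <= local_objective loss (x k) v.
  by have [w hw <-] := hFlstar k; apply: hw.
have L_ge_mu : mu <= L.
  (* Weights summing to one force at least one device to exist. *)
  have [k _|N0] := pickP 'I_N.
    exact: smooth_convex_le hd (hsmooth k) (hconvex k).
  by move: hp1; rewrite big1 => [/esym/eqP|k]; [rewrite oner_eq0 | have := N0 k].
have L_gt0 : 0 < L by apply: lt_le_trans L_ge_mu.
have gammaE : E%:R <= gamma by rewrite le_max lexx orbT.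
have gamma1 : 1 <= gamma by rewrite (le_trans _ gammaE) // ler1n.
have gammaL : 8 * L <= mu * gamma.
  have -> : 8 * L = mu * (8 * (L / mu)) by field; rewrite gt_eqF.
  by rewrite ler_pM2l // le_max lexx.
have denom_gt0 t : 0 < mu * (gamma + t%:R).
  by rewrite mulr_gt0 // ltr_wpDr ?ler0n // (lt_le_trans _ gamma1).
have eta_gt0 t : 0 < eta t by rewrite heta divr_gt0.
(* From [gamma >= 8 kappa]: [eta_t <= 2 / (mu gamma) <= 1 / (4 L)]. *)
have eta_L t : eta t * L <= 4^-1.
  rewrite heta mulrAC ler_pdivrMr //.
  have : 0 <= mu * t%:R by rewrite mulr_ge0 ?ler0n // ltW.
  rewrite mulrDr; lra.
(* From [gamma >= E]: within a round [gamma + t <= gamma + s + E <= 2 (gamma + s)]. *)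
have eta_slow t s : (t < s + E)%N -> (s <= t)%N -> 0 <= eta s <= 2 * eta t.
  move=> ts _; rewrite (ltW (eta_gt0 s)) !heta mulrA ler_pdivrMr //.
  rewrite mulrAC ler_pdivlMr // -mulrA ler_pM2l // mulrCA ler_pM2l //.
  have : t%:R <= s%:R + E%:R :> R by rewrite -natrD ler_nat ltnW.
  have : 0 <= s%:R :> R by rewrite ler0n.
  lra.
(* The horizon is [T'.+1], so the draws that matter are those of steps 0 to [T']. *)
pose X (j : 'I_T'.+1 * 'I_N) : Omega -> 'I_(n j.2) := xi (val j.1, j.2).
pose draw omega : {dffun forall j : 'I_T'.+1 * 'I_N, 'I_(n j.2)} :=
  [ffun j => X j omega].
have expE g f : (forall omega, g omega = f (draw omega)) -> ('E_P[g] = (avg f)%:E)%E.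
  move=> gf; rewrite -(expectation_outcome P _ _ X).
  - by congr expectation.body; apply/funext.
  - by move=> j; exact: (hxi_meas (val j.1, j.2)).
  move=> a; apply: (uniform_independent_cylinder P (nat * 'I_N)%type
    (fun j => n j.2) xi _ (fun j : 'I_T'.+1 * 'I_N => (val j.1, j.2)) a) => //.
  by move=> [i k] [i' k'] [/val_inj -> ->].
have expE_le g f c : (forall omega, g omega = f (draw omega)) ->
    ('E_P[g] <= c%:E)%E -> avg f <= c.
  by move=> /expE ->; rewrite lee_fin.
have dataE omega s k : (s <= T')%N -> data omega s k = drawn T' n x (draw omega) s k.
  by move=> sT; rewrite hdata /drawn ffunE /X /= inordK.
have wlE omega t k : (t <= T'.+1)%N -> wl t k omega =
    local_model loss p eta E w0 (drawn T' n x (draw omega)) t k.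
  move=> tT; rewrite hwl; apply: local_model_eq => s l st.
  by rewrite dataE // -ltnS (leq_trans st).
have wbarE omega t : (t <= T'.+1)%N -> wbar t omega =
    average_model loss p eta E w0 (drawn T' n x (draw omega)) t.
  by move=> tT; rewrite hwbar; apply: eq_bigr => k _; rewrite -hwl wlE.
pose W t a := average_model loss p eta E w0 (drawn T' n x a) t - wstar.
pose delta t := avg (fun a => dotv (W t a) (W t a)).
have delta1 : 0 <= delta 1%N by apply: avg_ge0 => a; apply: dotvv_ge0.
have B_ge0 : 0 <= B.
  have G0 := heterogeneity_ge0 p _ Flstar wstar hp Fl_min.
  rewrite hB hGamma !addr_ge0 //.
  - by apply: sumr_ge0 => k _; rewrite mulr_ge0 ?sqr_ge0.
  - by apply: mulr_ge0; [rewrite mulr_ge0 // ltW | exact: G0].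
  - apply: mulr_ge0; last exact: sqr_ge0.
    by apply: mulr_ge0; last exact: sqr_ge0.
have step t : (1 <= t < T'.+1)%N -> delta t.+1 <=
    (1 - mu * (2 / (mu * (gamma + t%:R)))) * delta t
    + (2 / (mu * (gamma + t%:R))) ^+ 2 * B.
  move=> /andP[_ tT]; rewrite -heta hB hGamma.
  apply: avg_descent => // [k s sT|k s sT|]; last exact: eta_slow.
  - apply: (expE_le _ _ _ _ (hvariance k s sT)) => omega.
    by rewrite enorm_sqr dataE // wlE // ltnW.
  - apply: (expE_le _ _ _ _ (hbounded k s sT)) => omega.
    by rewrite enorm_sqr dataE // wlE // ltnW.
have := harmonic_decay mu gamma B T'.+1 delta hmu gamma1 B_ge0 delta1 step
  T'.+1 (leqnn _).
have -> : ('E_P[fun omega => (enorm (wbar 1%N omega - wstar) ^+ 2)%R] = (delta 1%N)%:E)%E.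
  by apply: expE => omega; rewrite enorm_sqr wbarE.
pose Fw a := global_objective p (fun k => local_objective loss (x k))
  (average_model loss p eta E w0 (drawn T' n x a) T'.+1).
rewrite (expE _ Fw) => [deltaT|omega]; last by rewrite wbarE.
rewrite -EFinB -!(EFinM, EFinD) lee_fin lerBlDr.
have card_gt0 : (0 < #|{: {dffun forall j : 'I_T'.+1 * 'I_N, 'I_(n j.2)}}|)%N.
  by rewrite card_outcome prodn_gt0.
set Fs := global_objective _ _ wstar.
apply: (@le_trans _ _ (L / 2 * delta T'.+1 + Fs)).
  rewrite -(avg_cst Fs card_gt0) -avgZ -avgD; apply: le_avg => a.
  rewrite -lerBlDr; exact: global_gap_le hsmooth hwstar _.
rewrite lerD2r.
apply: (le_trans (ler_wpM2l _ deltaT)); first by rewrite divr_ge0 // ltW.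
have sT : 0 < gamma + T'.+1%:R - 1.
  by rewrite -addrA ltr_wpDr ?(lt_le_trans _ gamma1) // subr_ge0 ler1n.
move: (gamma + T'.+1%:R - 1) sT => s s0.
(* Both sides now coincide: [L / 2] times the decay bound is the claim with [kappa = L / mu]. *)
rewrite le_eqVlt; apply/orP; left; apply/eqP.
by field; rewrite !gt_eqF.
Qed.
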